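(* Let $m\ge 1$, $0\le n\le m$, and $\tau\in\operatorname{Conf}^{2m}_0(\mathbb{C})$. Then there is an injective holomorphic map from $\mathcal{Y}_{n,\tau}$ to the Hilbert scheme $\operatorname{Hilb}^n(S_\tau)$ of $n$ points on the affine surface $S_\tau=\{(u,v,z)\in\mathbb{C}^3: u^2+v^2+P_\tau(z)=0\}$.
   Context: $\operatorname{Conf}^{2m}_0(\mathbb{C})$ denotes the set of unordered $2m$-tuples $\tau=\{\mu_1,\dots,\mu_{2m}\}$ of pairwise distinct complex numbers with $\sum_k\mu_k=0$, and $P_\tau(t)=\prod_{k=1}^{2m}(t-\mu_k)$. Let $\mathcal{S}_n\subset\mathfrak{sl}_{2m}(\mathbb{C})$ be the affine subspace of matrices $X$ (indices $1,\dots,2m$, split into blocks of sizes $n$ and $2m-n$) whose only possibly nonzero entries are: $X_{i,1}=a_i$ $(1\le i\le n)$; $X_{i,i+1}=1$ for $1\le i\le n-1$; $X_{i,n+1}=b_i$ $(1\le i\le n)$; $X_{2m-n+i,1}=c_i$ $(1\le i\le n)$; $X_{n+i,n+1}=d_i$ $(1\le i\le 2m-n)$; $X_{n+i,n+i+1}=1$ for $1\le i\le 2m-n-1$; with $a_i,b_i,c_i,d_i\in\mathbb{C}$ and $a_1+d_1=0$. Put $A(t)=t^n-a_1t^{n-1}+a_2t^{n-2}-\dots+(-1)^na_n$, $B(t)=b_1t^{n-1}-b_2t^{n-2}+\dots+(-1)^{n-1}b_n$, $C(t)=c_1t^{n-1}-\dots+(-1)^{n-1}c_n$, $D(t)=t^{2m-n}-d_1t^{2m-n-1}+\dots+(-1)^{2m-n}d_{2m-n}$;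 then $\det(tI-X)=A(t)D(t)-B(t)C(t)$. The variety $\mathcal{Y}_{n,\tau}$ is the set of $X\in\mathcal{S}_n$ with characteristic polynomial $P_\tau$, i.e. the affine variety of tuples $(a_i,b_i,c_i,d_i)$ with $a_1+d_1=0$ and $A(t)D(t)-B(t)C(t)=P_\tau(t)$; it has complex dimension $2n$. *)

(* Defs.v *)
From HB Require Import structures.
From mathcomp Require Import all_boot all_order all_algebra.
From mathcomp Require Import complex.
From mathcomp Require Import all_classical all_reals all_analysis.
Set Implicit Arguments. Unset Strict Implicit. Unset Printing Implicit Defensive.
Import Order.TTheory GRing.Theory Num.Theory.
Import numFieldNormedType.Exports.
Local Open Scope ring_scope.

(* Ambient space of the parameters (a, b, c, d) of S_n:
   a, b, c in C^n and d in C^(2m-n) (0-based: a_i is a 0 (i-1)). *)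
Definition Amb (R : realType) (m n : nat) : normedModType R[i] :=
  ('rV[R[i]]_n * 'rV[R[i]]_n * 'rV[R[i]]_n * 'rV[R[i]]_(2 * m - n))%type.

Definition vnth (K : Type) (z : K) (p : nat) (v : 'rV[K]_p) (k : nat) : K :=
  if @insub _ (fun x : nat => (x < p)%N) 'I_p k is Some i then v 0 i else z.

(* The matrix X in S_n with parameters y = (a, b, c, d); the entries are
   given with 1-based indices I = i+1, J = j+1 as in the paper. *)
Definition Xmat (R : realType) (m n : nat) (y : Amb R m n) : 'M[R[i]]_(2 * m) :=
  let a := y.1.1.1 in let b := y.1.1.2 in let c := y.1.2 in let d := y.2 in
  \matrix_(i < 2 * m, j < 2 * m)
    let I := i.+1 in let J := j.+1 in
    if (J == 1%N) && (I <= n)%N then vnth 0 a (I - 1)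
    else if (J == I.+1) && (I <= n - 1)%N then 1
    else if (J == n.+1) && (I <= n)%N then vnth 0 b (I - 1)
    else if (J == 1%N) && (2 * m - n < I)%N then vnth 0 c (I - (2 * m - n) - 1)
    else if (J == n.+1) && (n < I)%N then vnth 0 d (I - n - 1)
    else if (J == I.+1) && (n < I)%N && (I <= 2 * m - 1)%N then 1
    else 0.

Definition Ptau (R : realType) (m : nat) (mu : 'I_(2 * m) -> R[i]) : {poly R[i]} :=
  \prod_(k < 2 * m) ('X - (mu k)%:P).

(* The variety Y_{n,tau}: X in S_n (in particular trace zero, i.e. a_1+d_1=0)
   with characteristic polynomial P_tau. *)
Definition inY (R : realType) (m n : nat) (mu : 'I_(2 * m) -> R[i])
    (y : Amb R m n) : Prop :=
  \tr (Xmat y) = 0 /\ char_poly (Xmat y) = Ptau mu.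

(* Polynomials in (u, v, z): C[z][v][u]. *)
Definition poly3 (R : realType) := {poly {poly {poly R[i]}}}.

Definition surf_eq (R : realType) (P : {poly R[i]}) : poly3 R :=
  'X^2 + ('X^2 + P%:P)%:P.

Definition is_ideal (R : realType) (I : poly3 R -> Prop) : Prop :=
  I 0 /\ (forall f g, I f -> I g -> I (f + g)) /\ (forall f g, I g -> I (f * g)).

Definition colength (R : realType) (I : poly3 R -> Prop) (n : nat) : Prop :=
  exists b : 'I_n -> poly3 R, forall f : poly3 R,
    exists! c : 'rV[R[i]]_n, I (f - \sum_(k < n) (c 0 k)%:P%:P%:P * b k).

(* Points of Hilb^n(S) for S = {F = 0} in C^3: ideals of C[u,v,z]
   containing F with quotient of dimension n (= ideals of C[S] of colength n). *)
Definition hilb_point (R : realType) (F : poly3 R) (n : nat) (I : poly3 R -> Prop) : Prop :=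
  is_ideal I /\ I F /\ colength I n.

Definition act (R : realType) (n : nat) (f : poly3 R) (Xu Xv Xz : 'M[R[i]]_n)
    (w : 'cV[R[i]]_n) : 'cV[R[i]]_n :=
  \sum_(p < size f) \sum_(q < size f`_p) \sum_(r < size (f`_p)`_q)
     ((f`_p)`_q)`_r *: (Xu ^+ p *m Xv ^+ q *m Xz ^+ r *m w).

(* Holomorphy of a map Phi : Y -> Hilb^n(C^3) (points represented as ideals),
   via the standard local charts of Hilb^n(C^3) = {commuting (Xu,Xv,Xz) with
   cyclic vector w} / GL_n: near every point of Y, Phi is induced by a
   commuting triple and a vector that are restrictions to Y of holomorphic
   (C-differentiable) functions on an open subset of the ambient space. *)
Definition hol_to_hilb (R : realType) (m n : nat) (Y : Amb R m n -> Prop)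
    (Phi : Amb R m n -> (poly3 R -> Prop)) : Prop :=
  forall y0, Y y0 ->
  exists (U : set (Amb R m n)) (Xu Xv Xz : Amb R m n -> 'M[R[i]]_n)
         (w : Amb R m n -> 'cV[R[i]]_n),
    [/\ open U, U y0,
        (forall x, U x -> [/\ differentiable Xu x, differentiable Xv x,
                              differentiable Xz x & differentiable w x]) &
        (forall y, U y -> Y y ->
           [/\ Xu y *m Xv y = Xv y *m Xu y, Xu y *m Xz y = Xz y *m Xu y,
               Xv y *m Xz y = Xz y *m Xv y &
               forall f, Phi y f <-> act f (Xu y) (Xv y) (Xz y) (w y) = 0])].

(* Main.v *)
Require Import Defs.
From HB Require Import structures.
From mathcomp Require Import all_boot all_order all_algebra.
From mathcomp Require Import complex.
From mathcomp Require Import all_classical all_reals all_analysis.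
From mathcomp Require Import zify ring.
Set Implicit Arguments. Unset Strict Implicit. Unset Printing Implicit Defensive.
Import Order.TTheory GRing.Theory Num.Theory.
Import numFieldNormedType.Exports.
Local Open Scope ring_scope.

(* Replace (u, v) by x = u + 'i v and x' = u - 'i v, so that the surface becomes
   x x' + P = 0.  A point of Y_{n,tau} is a quadruple (A, B, C, D) of polynomials
   with A D - B C = P and A monic of degree n, so x = B, x' = C solves the
   equation modulo A.  The map sends it to the ideal (A(z), x - B(z), x' - C(z)),
   whose quotient C[z]/(A) has the basis 1, z, ..., z^(n-1).  The ideal determines
   A and the residues B, C of degree < n, and then D is determined by
   A D = P + B C.  In the charts of the Hilbert scheme, z acts by the companion
   matrix of A and u, v act by polynomials in it, with cyclic vector 1.  These
   matrices depend polynomially on the parameters. *)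

(* Both sides are determinants of products with the block matrix [M, U; V, 1];
   over a field this is the matrix determinant lemma det (M - U V) =
   det M * det (1 - V M^-1 U), with V M^-1 written as T^-1 L. *)
Lemma det_rank_update (A : comNzRingType) (N r : nat) (M : 'M[A]_N)
    (U : 'M[A]_(N, r)) (V L : 'M[A]_(r, N)) (T : 'M[A]_r) :
  L *m M = T *m V -> \det T * \det (M - U *m V) = \det M * \det (T - L *m U).
Proof.
move=> LM; pose K := block_mx M U V 1%:M.
have KV : K *m block_mx 1%:M 0 (- V) 1%:M = block_mx (M - U *m V) U 0 1%:M.
  by rewrite mulmx_block !mulmx1 !mulmx0 !mul1mx !add0r !mulmxN subrr.
have LK : block_mx 1%:M 0 (- L) T *m K = block_mx M U 0 (T - L *m U).
  rewrite mulmx_block !mulmx1 !mul0mx !mul1mx !addr0 !mulNmx LM addNr.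
  by rewrite addrC.
have /esym := congr1 determinant LK; have /esym := congr1 determinant KV.
by rewrite !det_mulmx !det_ublock !det_lblock !det1 !mulr1 mul1r => -> ->.
Qed.

(** * Parameter vectors as polynomials *)

Lemma vnth_ord (K : Type) (z : K) (p : nat) (v : 'rV[K]_p) (k : 'I_p) :
  vnth z v k = v 0 k.
Proof. by rewrite /vnth valK. Qed.

Lemma vnth_default (K : Type) (z : K) (p : nat) (v : 'rV[K]_p) (k : nat) :
  (p <= k)%N -> vnth z v k = z.
Proof. by move=> pk; rewrite /vnth insubF // ltnNge pk. Qed.

(* For the matrices [Xmat], whose superdiagonal entries are +1, the blocks of the
   characteristic polynomial are A = X^n - revp a, B = revp b, C = revp c and
   D = X^(2m-n) - revp d, without the alternating signs of the paper (which
   amount to a change of signs of the parameters). *)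
Definition revp (K : nzRingType) (p : nat) (v : 'rV[K]_p) : {poly K} :=
  \sum_(k < p) v 0 k *: 'X^(p - 1 - k).

Lemma coef_revp (K : nzRingType) (p : nat) (v : 'rV[K]_p) (k : nat) :
  (k < p)%N -> (revp v)`_k = vnth 0 v (p - 1 - k).
Proof.
move=> kp; rewrite coef_sum.
have lt : (p - 1 - k < p)%N by lia.
rewrite (bigD1 (Ordinal lt)) //= big1 ?addr0 => [|i ne_i].
  rewrite coefZ coefXn (_ : _ == _ = true) ?mulr1 -?(vnth_ord 0 v) //; lia.
rewrite coefZ coefXn (_ : _ == _ = false) ?mulr0 //.
by move: ne_i (ltn_ord i); rewrite -val_eqE /=; lia.
Qed.

Lemma size_revp (K : nzRingType) (p : nat) (v : 'rV[K]_p) :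
  (size (revp v) <= p)%N.
Proof.
apply: (big_ind (fun q : {poly K} => size q <= p)%N) => [|q r qp rp|i _].
- by rewrite size_poly0.
- by rewrite (leq_trans (size_polyD _ _)) // geq_max qp.
- rewrite (leq_trans (size_scale_leq _ _)) // size_polyXn.
  by have := ltn_ord i; lia.
Qed.

Lemma revp_inj (K : nzRingType) (p : nat) : injective (@revp K p).
Proof.
move=> v1 v2 E; apply/rowP => k; have := ltn_ord k => kp.
have := congr1 (fun q : {poly K} => q`_(p - 1 - k)) E.
rewrite !coef_revp; try lia.
by rewrite (_ : p - 1 - (p - 1 - k) = k)%N ?vnth_ord //; lia.
Qed.

Lemma revpD (K : nzRingType) (p : nat) (v1 v2 : 'rV[K]_p) :
  revp (v1 + v2) = revp v1 + revp v2.
Proof. by rewrite -big_split; apply: eq_bigr => k _; rewrite mxE scalerDl. Qed.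

Lemma revpZ (K : nzRingType) (p : nat) (c : K) (v : 'rV[K]_p) :
  revp (c *: v) = c *: revp v.
Proof. by rewrite scaler_sumr; apply: eq_bigr => k _; rewrite mxE scalerA. Qed.

(** The default value 0 of [vnth] cuts the sum off after [p] terms, so a column padded with zeros
    contributes only its parameters. *)
Lemma sum_vnth (K : nzRingType) (p N o : nat) (v : 'rV[K]_p) (F : nat -> {poly K}) :
  (o + p <= N)%N ->
  \sum_(i < N | (o <= i)%N) vnth 0 v (i - o) *: F i =
  \sum_(k < p) v 0 k *: F (o + k)%N.
Proof.
move=> opN; pose G i := vnth 0 v (i - o) *: F i.
transitivity (\sum_(0 + o <= i < N) G i).
  by rewrite add0n big_geq_mkord.
rewrite big_addn big_mkord.
transitivity (\sum_(k < N - o | (k < p)%N) G (k + o)%N).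
  rewrite [RHS]big_mkcond; apply: eq_bigr => k _; case: ltnP => // pk.
  by rewrite /G addnK vnth_default ?scale0r.
rewrite -(big_ord_widen _ (fun k => G (k + o)%N)); last by lia.
by apply: eq_bigr => k _; rewrite /G addnK vnth_ord addnC.
Qed.

(** * The characteristic polynomial of the slice matrices *)

Section CharPoly.
Variables (R : realType) (m n : nat).
Hypotheses (m_gt0 : (0 < m)%N) (le_nm : (n <= m)%N).
Variable y : Amb R m n.
Local Notation K := R[i].
Local Notation a := y.1.1.1.
Local Notation b := y.1.1.2.
Local Notation c := y.1.2.
Local Notation d := y.2.

(* [Xmat y] is the constant nilpotent matrix [J] changed in columns 0 and n only,
   that is, by the matrix [U *m V] of rank at most two. *)
Let J : 'M[K]_(2 * m) :=
  \matrix_(i, j) ((j == i.+1 :> nat) && (i.+1 != n))%:R.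
(** The factor [0 < n] turns the first row off when [n = 0], since columns 0 and [n] then
    coincide. *)
Let V : 'M[K]_(2, 2 * m) := \matrix_(k, j)
  (if k == 0 then (j == 0%N :> nat) && (0 < n)%N else j == n :> nat)%:R.
(** The guards keep truncated subtraction from reading entry 0 in earlier rows. The two summands
    have disjoint supports because [n <= m]. *)
Let U : 'M[K]_(2 * m, 2) := \matrix_(i, k)
  if k == 0 then
    vnth 0 a i +
    (if (2 * m - n <= i)%N then vnth 0 c (i - (2 * m - n)) else 0)
  else vnth 0 b i + (if (n <= i)%N then vnth 0 d (i - n) else 0).

Lemma Xmat_rank_update : Xmat y = J + U *m V.
Proof.
apply/matrixP=> i j; rewrite !mxE !big_ord_recl big_ord0 addr0 !mxE /=.
have := ltn_ord i; have := ltn_ord j; move: (nat_of_ord i) (nat_of_ord j).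
move=> {}i {}j lt_j lt_i; rewrite !eqSS !subn1 /=.
have va k : (n <= k)%N -> vnth 0 a k = 0 by apply: vnth_default.
have vb k : (n <= k)%N -> vnth 0 b k = 0 by apply: vnth_default.
have pS k : ((i.+1 - k).-1 = i - k)%N by lia.
rewrite !pS !ltnS.
case: (ltnP i n) => [lt_in|le_ni].
  have -> : (i < n.-1)%N = (i.+1 != n) by lia.
  have -> : (2 * m - n <= i)%N = false by lia.
  rewrite !andbF !andbT !addr0 lt0n.
  have [->|j0] := eqVneq j 0%N.
    rewrite /= add0r.
    have -> : (0 == n)%N = false by lia.
    have -> : (n != 0)%N by lia.
    by rewrite mulr0 mulr1 addr0.
  have [->|jn] := eqVneq j n.
    have -> : (n == i.+1) && (i.+1 != n) = false by lia.
    by rewrite mulr0 !add0r mulr1.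
  by rewrite !mulr0 !addr0; case: andb.
rewrite va // vb // !andbT !andbF !add0r.
have -> : (j == i.+1) && (i < n.-1)%N = false by lia.
have -> : i.+1 != n by lia.
have [->|j0] := eqVneq j 0%N.
  rewrite /= !add0r; case: (posnP n) => [n0|n_gt0].
    have -> : (2 * m - n <= i)%N = false by lia.
    have -> : (0 == n)%N by lia.
    by rewrite mulr0 mulr1 add0r.
  have -> : (0 == n)%N = false by lia.
  by rewrite mulr1 mulr0 addr0; case: ifP.
rewrite mulr0 add0r andbT /=.
have [->|jn] := eqVneq j n.
  have -> : (n == i.+1) = false by lia.
  by rewrite add0r mulr1.
rewrite mulr0 addr0 /=.
have -> : (j == i.+1) && (i < (2 * m).-1)%N = (j == i.+1) by lia.
by case: eqP.
Qed.

Let M : 'M[{poly K}]_(2 * m) := 'X%:M - map_mx polyC J.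
(* The rows (X^(n-1), ..., X, 1 | 0) and (0 | X^(2m-n-1), ..., X, 1) cancel all
   columns of [M] except the first one of their block. *)
Let L : 'M[{poly K}]_(2, 2 * m) := \matrix_(k, i)
  if k == 0 then (if (i < n)%N then 'X^(n - 1 - i) else 0)
  else (if (n <= i)%N then 'X^(2 * m - 1 - i) else 0).
Let T : 'M[{poly K}]_2 := diag_mx (\row_k (if k == 0 then 'X^n else 'X^(2 * m - n))).

(** [J] is strictly upper triangular, so [M] is triangular with diagonal entries ['X]. *)
Lemma det_nilpotent_part : \det M = 'X^(2 * m).
Proof.
rewrite -det_tr det_trig; last first.
  apply/is_trig_mxP => i j lt_ij; rewrite !mxE.
  have -> : (j == i) = false by rewrite -val_eqE /=; lia.
  have -> : (i == j.+1 :> nat) && (j.+1 != n) = false by lia.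
  by rewrite mulr0n subrr.
rewrite -[in RHS](card_ord (2 * m)) -prodr_const; apply: eq_bigr => i _.
rewrite !mxE eqxx mulr1n.
have -> : (i == i.+1 :> nat) && (i.+1 != n) = false by lia.
by rewrite subr0.
Qed.

(** Column [j] of [M] has ['X] in row [j] and at most a -1 in row [j - 1], so consecutive powers in
    [L] telescope. At the head of a block there is no -1, and the top power survives. *)
Lemma mul_L_M : L *m M = T *m map_mx polyC V.
Proof.
apply/matrixP=> k j; rewrite mul_diag_mx mulmxBr mul_mx_scalar.
have LJ : (L *m map_mx polyC J) k j =
    if (j : nat) is j'.+1 then (if j'.+1 != n then
      if k == 0 then (if (j' < n)%N then 'X^(n - 1 - j') else 0)
      else (if (n <= j')%N then 'X^(2 * m - 1 - j') else 0) else 0) else 0.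
  rewrite mxE; case def_j: (nat_of_ord j) => [|j'].
    by rewrite big1 // => i _; rewrite !mxE def_j mulr0.
  have lt_j' : (j' < 2 * m)%N by have := ltn_ord j; lia.
  rewrite (bigD1 (Ordinal lt_j')) //= big1 ?addr0 => [|i ne_i].
    by rewrite !mxE def_j eqxx /=; case: (j'.+1 != n); rewrite ?mulr1 ?mulr0.
  have -> : (map_mx polyC J) i j = 0; last by rewrite mulr0.
  rewrite !mxE def_j eqSS; case: eqP => [def_i|] //=.
  by case/eqP: ne_i; apply: val_inj.
rewrite [LHS]mxE [X in _ + X]mxE LJ !mxE; have := ltn_ord j.
move: (nat_of_ord j) => {LJ}j lt_j.
case: (k == 0); case: j lt_j => [|j] lt_j /=.
- rewrite subr0; case: posnP => [->|n0]; rewrite ?mulr0 // mulr1 -exprS.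
  by congr (_ ^+ _); lia.
- rewrite mulr0; have [->|ne_jn] := eqVneq j.+1 n.
    by rewrite ltnn mulr0 subr0.
  case: (ltnP j.+1 n) => lt_jn.
    have -> : (j < n)%N by lia.
    by rewrite -exprS; apply/eqP; rewrite subr_eq0; apply/eqP; congr (_ ^+ _); lia.
  have -> : (j < n)%N = false by lia.
  by rewrite mulr0 subr0.
- rewrite subr0 leqn0 (eq_sym 0%N); case: eqP => [->|_]; rewrite ?mulr0 // mulr1 -exprS.
  by congr (_ ^+ _); lia.
- have [->|ne_jn] := eqVneq j.+1 n.
    rewrite leqnn subr0 mulr1 -exprS; congr (_ ^+ _); lia.
  rewrite mulr0; case: (leqP n j.+1) => le_nj.
    have -> : (n <= j)%N by lia.
    by rewrite -exprS; apply/eqP; rewrite subr_eq0; apply/eqP; congr (_ ^+ _); lia.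
  have -> : (n <= j)%N = false by lia.
  by rewrite mulr0 subr0.
Qed.

(** The exponents in [L] fall as the parameter index grows. In the last [n] rows, occupied by [c],
    they run from [n - 1] down to 0. *)
Lemma mul_L_U : L *m map_mx polyC U =
  \matrix_(k, l) if k == 0 then (if l == 0 then revp a else revp b)
                 else (if l == 0 then revp c else revp d).
Proof.
apply/matrixP=> k l; rewrite !mxE.
case: (k =P 0) => [k0|k0].
  transitivity (\sum_(i < 2 * m | (0 <= i)%N)
      vnth 0 (if l == 0 then a else b) (i - 0) *: 'X^(n - 1 - i) : {poly K}).
    apply: eq_bigr => i _; rewrite !mxE k0 eqxx subn0 mulrC mul_polyC.
    case: ltnP => [lt_in|le_ni].
      have -> : (2 * m - n <= i)%N = false by lia.
      by case: (l == 0); rewrite addr0.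
    by rewrite scaler0; case: (l == 0); rewrite vnth_default ?scale0r.
  rewrite (sum_vnth _ (fun i => 'X^(n - 1 - i))); last lia.
  by case: (l == 0).
move/eqP/negbTE in k0.
transitivity (\sum_(i < 2 * m | (n <= i)%N) (U i l) *: 'X^(2 * m - 1 - i) : {poly K}).
  rewrite [RHS]big_mkcond; apply: eq_bigr => i _; rewrite !mxE k0 mulrC mul_polyC.
  by case: (n <= i)%N; rewrite ?scaler0.
case: (l =P 0) => [l0|l0].
  transitivity (\sum_(i < 2 * m | (2 * m - n <= i)%N)
      vnth 0 c (i - (2 * m - n)) *: 'X^(2 * m - 1 - i) : {poly K}).
    rewrite [LHS]big_mkcond [RHS]big_mkcond; apply: eq_bigr => i _; rewrite mxE l0 eqxx.
    case: leqP => [le_ni|lt_in].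
      by rewrite vnth_default // add0r; case: leqP; rewrite // scale0r.
    by have -> : (2 * m - n <= i)%N = false by lia.
  rewrite (sum_vnth _ (fun i => 'X^(2 * m - 1 - i))); last lia.
  by apply: eq_bigr => i _; congr (_ *: 'X^_); lia.
move/eqP/negbTE in l0.
transitivity (\sum_(i < 2 * m | (n <= i)%N)
    vnth 0 d (i - n) *: 'X^(2 * m - 1 - i) : {poly K}).
  apply: eq_bigr => i le_ni; rewrite mxE l0 le_ni.
  by rewrite vnth_default // add0r.
rewrite (sum_vnth _ (fun i => 'X^(2 * m - 1 - i))); last lia.
by apply: eq_bigr => i _; congr (_ *: 'X^_); lia.
Qed.

Lemma char_poly_Xmat :
  char_poly (Xmat y) =
    ('X^n - revp a) * ('X^(2 * m - n) - revp d) - revp b * revp c.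
Proof.
have detT : \det T = 'X^(2 * m).
  rewrite det_diag !big_ord_recl big_ord0 mulr1 !mxE /= -exprD.
  by congr (_ ^+ _); lia.
have mapX : char_poly_mx (Xmat y) = M - map_mx polyC U *m map_mx polyC V.
  by rewrite /char_poly_mx Xmat_rank_update map_mxD map_mxM opprD addrA.
have := det_rank_update (map_mx polyC U) mul_L_M.
(* [\det T] and [\det M] both equal ['X^(2 * m)], which cancels and leaves a 2 by 2 determinant. *)
rewrite -mapX detT det_nilpotent_part => /mulfI E.
rewrite /char_poly {}E; last by rewrite expf_neq0 ?polyX_eq0.
rewrite mul_L_U (expand_det_row _ 0) !big_ord_recl big_ord0 /cofactor !det_mx11.
rewrite !mxE /= !mulr1n !mulr0n /bump /= expr0 expr1; ring.
Qed.

End CharPoly.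

(* Multiplication by z on K[z]/(z^n - revp a) in the basis 1, z, ..., z^(n-1), in
   which [e0] is the class of 1. *)
Definition shift_mx (K : nzRingType) (n : nat) (a : 'rV[K]_n) : 'M[K]_n :=
  \matrix_(i, j) if j.+1 == n then a 0 (rev_ord i) else (i == j.+1 :> nat)%:R.

Definition e0 (K : nzRingType) (n : nat) : 'cV[K]_n := \col_i (i == 0%N :> nat)%:R.

(** The value of [revp v] at [shift_mx a], as an explicit sum that covers [n = 0] and is visibly
    polynomial in the parameters. *)
Definition revp_mx (K : nzRingType) (n : nat) (a v : 'rV[K]_n) : 'M[K]_n :=
  \sum_(k < n) v 0 k *: shift_mx a ^+ (n - 1 - k).

(** * Companion matrices and their cyclic vector *)

Section Companion.
Variables (K : comNzRingType) (n : nat).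
Implicit Types a v : 'rV[K]_n.+1.

(** Up to degree [n] no reduction modulo the monic polynomial occurs. *)
Lemma shift_mx_expr a (k : nat) : (k <= n)%N ->
  shift_mx a ^+ k *m e0 K n.+1 = \col_i (i == k :> nat)%:R.
Proof.
elim: k => [_|k IHk lt_kn]; first by rewrite expr0 mul1mx.
rewrite exprS -mulmxA IHk ?(ltnW lt_kn) //.
apply/colP => i; rewrite !mxE (bigD1 (inord k)) //= big1 => [|j ne_j].
  rewrite !mxE inordK ?(leqW lt_kn) // eqxx mulr1 addr0 eqSS ifN //.
  by rewrite neq_ltn lt_kn.
rewrite !mxE (_ : (j == k :> nat) = false) ?mulr0 //.
by apply: contraNF ne_j => /eqP <-; rewrite inord_val.
Qed.

(** By linearity from the powers. Hence [e0] is cyclic, and a polynomial of degree at most [n] is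
    recovered from its action on [e0]. *)
Lemma horner_shift_mx_e0 a (f : {poly K}) : (size f <= n.+1)%N ->
  horner_mx (shift_mx a) f *m e0 K n.+1 = \col_i f`_i.
Proof.
move=> le_f; rewrite -[f in LHS](coefK f) poly_def linear_sum mulmx_suml.
rewrite (big_ord_widen _
  (fun i => horner_mx (shift_mx a) (f`_i *: 'X^i) *m e0 K n.+1) le_f).
apply/colP => i; rewrite summxE mxE.
rewrite big_mkcond (bigD1 i) //= big1 ?addr0 => [|j ne_ji]; last first.
  case: ltnP => // _; rewrite linearZ rmorphXn /= horner_mx_X -scalemxAl.
  rewrite shift_mx_expr -1?ltnS // !mxE eq_sym.
  by move: ne_ji; rewrite -val_eqE => /negbTE /= ->; rewrite mulr0.
case: ltnP => [_|/(nth_default 0) ->] //.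
rewrite linearZ rmorphXn /= horner_mx_X -scalemxAl shift_mx_expr -1?ltnS //.
by rewrite !mxE eqxx mulr1.
Qed.

Lemma horner_revp a v : horner_mx (shift_mx a) (revp v) = revp_mx a v.
Proof.
rewrite linear_sum; apply: eq_bigr => k _.
by rewrite linearZ rmorphXn /= horner_mx_X.
Qed.

Lemma revp_mx_e0 a v : revp_mx a v *m e0 K n.+1 = \col_i v 0 (rev_ord i).
Proof.
rewrite -horner_revp horner_shift_mx_e0 ?size_revp //.
apply/colP => i; rewrite !mxE coef_revp // -(vnth_ord 0 v); congr (vnth _ _ _).
by rewrite /=; lia.
Qed.

Lemma horner_mxB_eq0 (X : 'M[K]_n.+1) (p q : {poly K}) (w : 'cV[K]_n.+1) :
  horner_mx X p *m w = 0 -> horner_mx X q *m w = 0 ->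
  horner_mx X (p - q) *m w = 0.
Proof. by move=> hp hq; rewrite rmorphB mulmxBl /= hp hq subrr. Qed.

Lemma horner_revpB_eq0 a v1 v2 :
  horner_mx (shift_mx a) (revp v1 - revp v2) *m e0 K n.+1 = 0 -> v1 = v2.
Proof.
rewrite -scaleN1r -revpZ -revpD scaleN1r horner_revp revp_mx_e0 => /colP Ev.
apply/eqP; rewrite -subr_eq0; apply/eqP/rowP => k.
by have := Ev (rev_ord k); rewrite !mxE rev_ordK.
Qed.

(** The power [n] sends [e0] to the last basis vector, which the matrix then sends to its last
    column, the coefficients of [revp a]. *)
Lemma horner_monic_e0 a :
  horner_mx (shift_mx a) ('X^(n.+1) - revp a) *m e0 K n.+1 = 0.
Proof.
rewrite rmorphB rmorphXn /= horner_mx_X horner_revp mulmxBl revp_mx_e0.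
rewrite exprS -mulmxA shift_mx_expr //; apply/eqP; rewrite subr_eq0; apply/eqP.
apply/colP => i; rewrite !mxE (bigD1 ord_max) //= big1 => [|j ne_j].
  by rewrite !mxE /= !eqxx mulr1 addr0.
rewrite !mxE (_ : (j == n :> nat) = false) ?mulr0 //.
by apply: contraNF ne_j => /eqP jn; apply/eqP/val_inj.
Qed.

End Companion.

(** * Evaluation at commuting matrices and ideals of finite colength *)

Lemma horner_morph_sum (A B : nzRingType) (f : {rmorphism A -> B}) (u : B)
    (cfu : commr_rmorph f u) (p : {poly A}) :
  horner_morph cfu p = \sum_(i < size p) f p`_i * u ^+ i.
Proof.
rewrite -[p in LHS](coefK p) poly_def rmorph_sum; apply: eq_bigr => i _.
by rewrite /= -mul_polyC rmorphM rmorphXn /= horner_morphC horner_morphX.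
Qed.

(** Evaluate one variable at a time, z, then v, then u. Each stage is a ring morphism because the
    new matrix commutes with the image of the previous stage. *)
Lemma act_rmorph (R : realType) (n : nat) (Xu Xv Xz : 'M[R[i]]_n.+1) :
  Xu *m Xv = Xv *m Xu -> Xu *m Xz = Xz *m Xu -> Xv *m Xz = Xz *m Xv ->
  exists ev : {rmorphism poly3 R -> 'M[R[i]]_n.+1},
    [/\ ev 'X = Xu, ev 'X%:P = Xv,
        forall p, ev p%:P%:P = horner_mx Xz p &
        forall f w, act f Xu Xv Xz w = ev f *m w].
Proof.
move=> Cuv Cuz Cvz.
have Cv : commr_rmorph (horner_mx Xz) Xv by move=> p; apply/comm_mx_horner.
pose evv : {rmorphism {poly {poly R[i]}} -> 'M[R[i]]_n.+1} := horner_morph Cv.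
have evvE p : evv p = \sum_(q < size p) horner_mx Xz p`_q * Xv ^+ q.
  exact: horner_morph_sum.
have Cu : commr_rmorph evv Xu.
  move=> p; rewrite evvE; apply: commr_sum => q _.
  by apply: commrM; [apply/comm_mx_horner|apply: commrX].
exists (horner_morph Cu); split.
- exact: horner_morphX.
- by rewrite /= horner_morphC /= horner_morphX.
- by move=> p; rewrite /= horner_morphC /= horner_morphC.
move=> f w; rewrite /= horner_morph_sum mulmx_suml; apply: eq_bigr => p _.
(* [horner_morph] puts coefficients on the left of the powers and [act] puts them on the right;
   commutation reconciles the two. *)
rewrite (commrX p (commr_sym (Cu _))) evvE mulr_sumr mulmx_suml; apply: eq_bigr => q _.
rewrite (commrX q (commr_sym (Cv _))) [horner_mx _ _]horner_morph_sum !mulr_sumr mulmx_suml.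
apply: eq_bigr => r _; rewrite -mulmxE mul_scalar_mx -!scalemxAr -scalemxAl.
by rewrite !mulmxE mulrA.
Qed.

(** The classes of 1, z, ..., z^n act on [e0] as the standard basis, so the coordinates of [f]
    modulo [I] are the entries of [ev f *m e0]. *)
Lemma hilb_point_ker (R : realType) (n : nat) (a : 'rV[R[i]]_n.+1) (F : poly3 R)
    (ev : {rmorphism poly3 R -> 'M[R[i]]_n.+1}) (I : poly3 R -> Prop) :
  (forall p, ev p%:P%:P = horner_mx (shift_mx a) p) ->
  (forall f, I f <-> ev f *m e0 _ n.+1 = 0) ->
  I F -> hilb_point F n.+1 I.
Proof.
move=> evC IE IF; split; last split => //.
  split; [|split].
  - by apply/IE; rewrite rmorph0 mul0mx.
  - by move=> f g /IE f0 /IE g0; apply/IE; rewrite rmorphD mulmxDl f0 g0 addr0.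
  - by move=> f g /IE g0; apply/IE; rewrite rmorphM /= -mulmxE -mulmxA g0 mulmx0.
exists (fun k => ('X^k)%:P%:P) => f.
have evb (c : 'rV[R[i]]_n.+1) :
    ev (\sum_(k < n.+1) (c 0 k)%:P%:P%:P * ('X^k)%:P%:P) *m e0 _ n.+1 = c^T.
  have -> : \sum_(k < n.+1) (c 0 k)%:P%:P%:P * ('X^k)%:P%:P =
      (\poly_(k < n.+1) vnth 0 c k)%:P%:P :> poly3 R.
    rewrite poly_def !rmorph_sum; apply: eq_bigr => k _.
    by rewrite vnth_ord -mul_polyC /= !rmorphM.
  rewrite evC horner_shift_mx_e0 ?size_poly //.
  by apply/colP => k; rewrite !mxE coef_poly ltn_ord vnth_ord.
exists (ev f *m e0 R[i] n.+1)^T; split => [|c /IE].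
  by apply/IE; rewrite rmorphB mulmxBl evb trmxK subrr.
by rewrite rmorphB mulmxBl evb => /eqP; rewrite subr_eq0 => /eqP ->; rewrite trmxK.
Qed.

(** * The map, and recovery of the parameters *)

Section Map.
Variables (R : realType) (m n : nat).
Implicit Types y : Amb R m n.

Definition Avec y : 'rV[R[i]]_n := y.1.1.1.
(** [uvec] and [vvec] solve b = u + 'i v and c = u - 'i v. *)
Definition uvec y : 'rV[R[i]]_n := 2^-1 *: (y.1.1.2 + y.1.2).
Definition vvec y : 'rV[R[i]]_n := (2 * 'i)^-1 *: (y.1.1.2 - y.1.2).

(** The annihilator of the class of 1 in C[z]/(A). Using [act] makes it literally the chart
    condition of [hol_to_hilb]. *)
Definition hilb_map y (f : poly3 R) : Prop :=
  act f (revp_mx (Avec y) (uvec y)) (revp_mx (Avec y) (vvec y))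
        (shift_mx (Avec y)) (e0 _ n) = 0.

(** Since 'i^2 = -1, the left side is ((B + C)^2 - (B - C)^2) / 4. *)
Lemma revp_uvec_vvec y :
  revp (uvec y) ^+ 2 + revp (vvec y) ^+ 2 = revp y.1.1.2 * revp y.1.2.
Proof.
rewrite /uvec /vvec !revpZ -scaleN1r !revpD revpZ scaleN1r !exprZn.
have -> : (2 * 'i)^-1 ^+ 2 = - (2^-1 ^+ 2) :> R[i].
  by rewrite exprVn exprMn sqrCi mulrN1 invrN exprVn.
rewrite scaleNr -scalerBr subr_sqr.
set B := revp _; set C := revp _.
have -> : (B + C - (B - C)) * (B + C + (B - C)) = 2 ^+ 2 *: (B * C) :> {poly R[i]}.
  rewrite expr2 -scalerA !scaler_nat. ring.
by rewrite scalerA -exprMn mulVf ?pnatr_eq0 // expr1n scale1r.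
Qed.

Lemma bvecE y : y.1.1.2 = uvec y + 'i *: vvec y.
Proof.
rewrite /uvec /vvec. rewrite scalerA invfM mulrCA mulfV ?neq0Ci // mulr1.
rewrite -scalerDr addrACA subrr addr0 -mulr2n.
rewrite -scalerMnr scalerMnl -[_ *+ 2]mulr_natr.
by rewrite mulVf ?pnatr_eq0 // scale1r.
Qed.

Lemma cvecE y : y.1.2 = uvec y - 'i *: vvec y.
Proof.
rewrite /uvec /vvec scalerA invfM mulrCA mulfV ?neq0Ci // mulr1.
rewrite -scalerBr opprB [y.1.2 - _]addrC addrACA subrr add0r -mulr2n.
rewrite -scalerMnr scalerMnl -[_ *+ 2]mulr_natr.
by rewrite mulVf ?pnatr_eq0 // scale1r.
Qed.

Lemma inY_ext (mu : 'I_(2 * m) -> R[i]) y1 y2 :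
  (0 < m)%N -> (n <= m)%N -> inY mu y1 -> inY mu y2 ->
  Avec y1 = Avec y2 -> uvec y1 = uvec y2 -> vvec y1 = vvec y2 -> y1 = y2.
Proof.
move=> m_gt0 le_nm [_ P1] [_ P2] Ea Eu Ev.
have Eb : y1.1.1.2 = y2.1.1.2 by rewrite !bvecE Eu Ev.
have Ec : y1.1.2 = y2.1.2 by rewrite !cvecE Eu Ev.
have Ed : y1.2 = y2.2.
  have := etrans P1 (esym P2); rewrite !char_poly_Xmat // Eb Ec.
  (* The products B C agree, and the common monic factor A is nonzero, so both cancel and leave the
     equality of the D. *)
  rewrite -[y1.1.1.1]/(Avec y1) Ea => /addIr /mulfI E.
  apply/revp_inj/oppr_inj/(addrI 'X^(2 * m - n))/E.
  by rewrite -size_poly_gt0 size_polyDl ?size_polyXn // size_polyN ltnS size_revp.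
case: y1 y2 Ea Eb Ec Ed {P1 P2 Eu Ev} => [[[a1 b1] c1] d1] [[[a2 b2] c2] d2] /=.
by rewrite /Avec /= => -> -> -> ->.
Qed.

End Map.

(** * The ideal of a point of the variety *)

Section IdealOfPoint.
Variables (R : realType) (m n : nat).
Implicit Types y : Amb R m n.+1.

Lemma revp_mx_comm y (v1 v2 : 'rV[R[i]]_n.+1) (a := Avec y) :
  [/\ revp_mx a v1 *m revp_mx a v2 = revp_mx a v2 *m revp_mx a v1 &
      revp_mx a v1 *m shift_mx a = shift_mx a *m revp_mx a v1].
Proof.
split; rewrite -!horner_revp; first exact: comm_horner_mx2.
exact: comm_horner_mx.
Qed.

Lemma hilb_map_rmorph y :
  exists ev : {rmorphism poly3 R -> 'M[R[i]]_n.+1},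
    [/\ ev 'X = horner_mx (shift_mx (Avec y)) (revp (uvec y)),
        ev 'X%:P = horner_mx (shift_mx (Avec y)) (revp (vvec y)),
        forall p, ev p%:P%:P = horner_mx (shift_mx (Avec y)) p &
        forall f, hilb_map y f <-> ev f *m e0 _ n.+1 = 0].
Proof.
have [Cuv Cuz] := revp_mx_comm y (uvec y) (vvec y).
have [_ Cvz] := revp_mx_comm y (vvec y) (vvec y).
have [ev [evX evXP evC actE]] := act_rmorph Cuv Cuz Cvz.
exists ev; split.
- exact: etrans evX (esym (horner_revp _ _)).
- exact: etrans evXP (esym (horner_revp _ _)).
- exact: evC.
- by move=> f; split; rewrite /hilb_map actE; apply.
Qed.

(** Modulo the ideal, u^2 + v^2 + P becomes B C + (A D - B C) = D A, and A kills [e0]. *)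
Lemma hilb_map_surf (mu : 'I_(2 * m) -> R[i]) y :
  (0 < m)%N -> (n < m)%N -> inY mu y -> hilb_map y (surf_eq (Ptau mu)).
Proof.
move=> m_gt0 lt_nm [_ <-]; rewrite char_poly_Xmat //.
have [ev [evX evXP evC hE]] := hilb_map_rmorph y; apply/hE.
set p := revp (uvec y) in evX *; set q := revp (vvec y) in evXP *.
have evS (P : {poly R[i]}) : ev (surf_eq P) = horner_mx (shift_mx (Avec y)) (p ^+ 2 + q ^+ 2 + P).
  rewrite [surf_eq P]/('X ^+ 2 + ('X ^+ 2 + P%:P)%:P) polyCD.
  rewrite [X in X + _](rmorphXn polyC 2 'X).
  rewrite (rmorphD ev) (rmorphXn ev 2 'X) (rmorphD ev) (rmorphXn ev 2) evX evXP evC.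
  pose h : {rmorphism _ -> _} := horner_mx (shift_mx (Avec y)).
  rewrite [RHS](rmorphD h _ P) [X in _ = X + _](rmorphD h (p ^+ 2)).
  rewrite [X in _ = X + _ + _](rmorphXn h 2 p) [X in _ = _ + X + _](rmorphXn h 2 q).
  exact: addrA.
rewrite evS revp_uvec_vvec addrC subrK mulrC rmorphM /= -mulmxE -mulmxA.
by rewrite horner_monic_e0 mulmx0.
Qed.

(** A(z), u - [revp (uvec y1)] and v - [revp (vvec y1)] lie in the first ideal, hence in the second.
    There each gives a difference of degree at most [n] killing [e0], which must vanish. *)
Lemma hilb_map_inj y1 y2 : (forall f, hilb_map y1 f <-> hilb_map y2 f) ->
  [/\ Avec y1 = Avec y2, uvec y1 = uvec y2 & vvec y1 = vvec y2].
Proof.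
have [ev1 [ev1X ev1XP ev1C h1E]] := hilb_map_rmorph y1.
have [ev2 [ev2X ev2XP ev2C h2E]] := hilb_map_rmorph y2.
move=> E.
have ker2 f : ev1 f *m e0 _ n.+1 = 0 -> ev2 f *m e0 _ n.+1 = 0.
  by move/h1E/E/h2E.
have eq_vec := @horner_revpB_eq0 _ _ (Avec y2).
split.
- apply: eq_vec.
  have -> : revp (Avec y1) - revp (Avec y2) =
      ('X^(n.+1) - revp (Avec y2)) - ('X^(n.+1) - revp (Avec y1)) by ring.
  apply: horner_mxB_eq0; first exact: horner_monic_e0.
  by rewrite -ev2C; apply: ker2; rewrite ev1C; exact: horner_monic_e0.
- apply/esym/eq_vec; have := ker2 ('X - (revp (uvec y1))%:P%:P).
  rewrite (rmorphB ev1) (rmorphB ev2) ev1X ev1C ev2X ev2C subrr mul0mx.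
  by rewrite (rmorphB (horner_mx (shift_mx (Avec y2)))) => ->.
- apply/esym/eq_vec; have := ker2 ('X%:P - (revp (vvec y1))%:P%:P).
  rewrite (rmorphB ev1) (rmorphB ev2) ev1XP ev1C ev2XP ev2C subrr mul0mx.
  by rewrite (rmorphB (horner_mx (shift_mx (Avec y2)))) => ->.
Qed.

End IdealOfPoint.

(** * Holomorphic dependence on the parameters *)

Section Differentiability.
Variables (K : numFieldType) (W : normedModType K).

(** Expansion in the matrix units [delta_mx i j] reduces the claim to scalar functions. *)
Lemma differentiable_mx (p q : nat) (F : W -> 'M[K]_(p, q)) (x : W) :
  (forall i j, differentiable (fun y => F y i j : K) x) -> differentiable F x.
Proof.
move=> dF.
have -> : F = \sum_(i < p) \sum_(j < q) (fun y => F y i j *: delta_mx i j).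
  apply/funext => y; rewrite fct_sumE [LHS]matrix_sum_delta.
  by apply: eq_bigr => i _; rewrite fct_sumE.
apply: differentiable_sum => i; apply: differentiable_sum => j.
exact: differentiableZl.
Qed.

Lemma differentiable_entry (p q : nat) (F : W -> 'M[K]_(p, q)) (x : W) i j :
  differentiable F x -> differentiable (fun y => F y i j : K) x.
Proof.
move=> dF; exact: (differentiable_comp dF (differentiable_coord _ _ _)).
Qed.

Lemma differentiable_mulmx (p q r : nat) (F : W -> 'M[K]_(p, q))
    (G : W -> 'M[K]_(q, r)) (x : W) :
  differentiable F x -> differentiable G x ->
  differentiable (fun y => F y *m G y) x.
Proof.
move=> dF dG; apply: differentiable_mx => i j.
have -> : (fun y => (F y *m G y) i j) =
    \sum_(k < q) ((fun y => F y i k : K) * (fun y => G y k j : K)).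
  by apply/funext => y; rewrite fct_sumE mxE.
apply: differentiable_sum => k.
by apply: differentiableM; apply: differentiable_entry.
Qed.

Lemma differentiable_shift_mx (n : nat) (v : W -> 'rV[K]_n) (x : W) :
  differentiable v x -> differentiable (fun y => shift_mx (v y)) x.
Proof.
move=> dv; apply: differentiable_mx => i j.
under eq_fun do rewrite mxE.
case: eqP => _; first exact: differentiable_entry.
exact: differentiable_cst.
Qed.

Lemma differentiable_revp_mx (n : nat) (a v : W -> 'rV[K]_n) (x : W) :
  differentiable a x -> differentiable v x ->
  differentiable (fun y => revp_mx (a y) (v y)) x.
Proof.
move=> da dv.
have dpow k : differentiable (fun y => shift_mx (a y) ^+ k) x.
  elim: k => [|k IHk].
    by under eq_fun do rewrite expr0; exact: differentiable_cst.
  under eq_fun do rewrite exprS.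
  by apply: differentiable_mulmx => //; exact: differentiable_shift_mx.
apply: differentiable_mx => i j.
have -> : (fun y => revp_mx (a y) (v y) i j) = \sum_(k < n)
    ((fun y => v y 0 k : K) * (fun y => (shift_mx (a y) ^+ (n - 1 - k)) i j : K)).
  apply/funext => y; rewrite fct_sumE summxE; apply: eq_bigr => k _.
  by rewrite mxE.
apply: differentiable_sum => k.
by apply: differentiableM; apply: differentiable_entry.
Qed.

End Differentiability.

Lemma differentiable_Amb (R : realType) (m n : nat) (x : Amb R m n) :
  [/\ differentiable (@Avec R m n) x, differentiable (@uvec R m n) x &
      differentiable (@vvec R m n) x].
Proof.
have dfst (V1 V2 : normedModType R[i]) (z : V1 * V2) : differentiable fst z.
  by apply: (linear_differentiable (f := fst : {linear _ -> _})) => ?; exact: cvg_fst.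
have dsnd (V1 V2 : normedModType R[i]) (z : V1 * V2) : differentiable snd z.
  by apply: (linear_differentiable (f := snd : {linear _ -> _})) => ?; exact: cvg_snd.
have d1 : differentiable (fun y : Amb R m n => y.1) x by exact: dfst.
have d11 : differentiable (fun y : Amb R m n => y.1.1) x.
  exact: (differentiable_comp d1 (dfst _ _ _)).
have da : differentiable (fun y : Amb R m n => y.1.1.1) x.
  exact: (differentiable_comp d11 (dfst _ _ _)).
have db : differentiable (fun y : Amb R m n => y.1.1.2) x.
  exact: (differentiable_comp d11 (dsnd _ _ _)).
have dc : differentiable (fun y : Amb R m n => y.1.2) x.
  exact: (differentiable_comp d1 (dsnd _ _ _)).
split; first exact: da.
  by apply: differentiableZ; exact: differentiableD.
by apply: differentiableZ; exact: differentiableB.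
Qed.

Lemma hilb_map_hol (R : realType) (m n : nat) (Y : Amb R m n -> Prop) :
  hol_to_hilb Y (@hilb_map R m n).
Proof.
(* A single chart suffices: the matrices are defined and differentiable on the whole ambient
   space. *)
move=> y0 _; exists setT, (fun y => revp_mx (Avec y) (uvec y)),
  (fun y => revp_mx (Avec y) (vvec y)), (fun y => shift_mx (Avec y)),
  (fun=> e0 R[i] n).
split; [exact: openT | exact: I | move=> x _ | move=> y _ _].
   have [da du dv] := differentiable_Amb x.
  split; [exact: differentiable_revp_mx|exact: differentiable_revp_mx| |].
    exact: differentiable_shift_mx.
  exact: differentiable_cst.
case: n y Y y0 => [|n] y Y y0.
  have mx0_eq (X Z : 'M[R[i]]_0) : X = Z by rewrite [X]thinmx0 [Z]thinmx0.
  by split; [exact: mx0_eq | exact: mx0_eq | exact: mx0_eq | ].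
have [Cuv Cuz] := revp_mx_comm y (uvec y) (vvec y).
have [_ Cvz] := revp_mx_comm y (vvec y) (vvec y).
split; [exact: Cuv | exact: Cuz | exact: Cvz | move=> f; exact: iff_refl].
Qed.

(** For zero points the quotient is the zero space, so the unit ideal is the point. *)
Lemma hilb_point0 (R : realType) (F : poly3 R) (I : poly3 R -> Prop) :
  (forall f, I f) -> hilb_point F 0 I.
Proof.
move=> IT; do 2![split => //].
exists (fun=> 0) => f; exists 0; split => // c _; exact/esym/thinmx0.
Qed.

Theorem theorem1p1 (R : realType) (m n : nat) (mu : 'I_(2 * m) -> R[i]) :
  (1 <= m)%N -> (n <= m)%N -> injective mu -> \sum_(k < 2 * m) mu k = 0 ->
  exists Phi : Amb R m n -> (poly3 R -> Prop),
    [/\ forall y, inY mu y -> hilb_point (surf_eq (Ptau mu)) n (Phi y),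
        forall y1 y2, inY mu y1 -> inY mu y2 ->
          (forall f, Phi y1 f <-> Phi y2 f) -> y1 = y2 &
        hol_to_hilb (inY mu) Phi].
Proof.
move=> m_gt0 le_nm _ _; exists (@hilb_map R m n).
split; last exact: hilb_map_hol.
- case: n le_nm => [|n] le_nm y Yy.
    by apply: hilb_point0 => f; exact: flatmx0.
  have [ev [_ _ evC hE]] := hilb_map_rmorph y.
  exact: hilb_point_ker evC hE (hilb_map_surf m_gt0 le_nm Yy).
- case: n le_nm => [|n] le_nm y1 y2 Y1 Y2 E.
    (* For [n = 0] the vectors a, u, v are empty, and the characteristic polynomial alone determines
       [d]. *)
    by apply: (inY_ext m_gt0 le_nm Y1 Y2); rewrite thinmx0 [RHS]thinmx0.
  by have [Ea Eu Ev] := hilb_map_inj E; exact: (inY_ext m_gt0 le_nm Y1 Y2).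
Qed.
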